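(* Let $G$ be a non-precompact abelian metrizable topological group, let $X$ be a $G$-Tychonoff first countable space, and let $H$ be a subgroup of $G^X$ (with the pointwise topology) containing $B_1(X,G)$. Then: (E) $H$ is locally compact if and only if $X$ is finite and $G$ is locally compact. (F) $H$ is cosmic if and only if $X$ is countable and $G$ is separable. (G) $H$ is analytic if and only if $X$ is countable and $G$ is analytic. (H) If $B_2(X,G)\subseteq H$, then $H$ is $K$-analytic if and only if $H$ is analytic if and only if $X$ is countable and $G$ is analytic.
   Context: All topological spaces are Tychonoff (completely regular Hausdorff); countable means finite or countably infinite. For Tychonoff spaces $X,Y$, $C(X,Y)$ is the set of continuous functions $X\to Y$. $X$ is $Y$-Tychonoff if for every closed $A\subseteq X$, every $x\in X\setminus A$ and every two distinct points $y,z\in Y$ there is $f\in C(X,Y)$ with $f(x)=y$ and $f(a)=z$ for all $a\in A$. Baire classes: $B_0(X,Y)=C(X,Y)$; for a countable ordinal $\alpha\geq 1$, $B_\alpha(X,Y)$ is the set of all $f:X\to Y$ that are pointwise limits of sequences from $\bigcup_{i<\alpha}B_i(X,Y)$; these sets carry the topology induced from the product $Y^X$. A topological group $G$ is precompact if for every neighborhood $U$ of the identity finitely many translates of $U$ cover $G$. A Tychonoff space is cosmic if it is a continuous image of a separable metrizable space; analytic if it is a continuous image of a Polish space; $K$-analytic if it is the image of $\mathbb N^{\mathbb N}$ under an usco (upper semicontinuous) compact-valued map defined on $\mathbb N^{\mathbb N}$. *)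

(* Defs.v *)
From HB Require Import structures.
From mathcomp Require Import all_boot all_order all_algebra.
From mathcomp Require Import all_classical all_reals all_analysis.

Set Implicit Arguments.
Unset Strict Implicit.
Unset Printing Implicit Defensive.

Import Order.TTheory GRing.Theory Num.Theory.
Import numFieldNormedType.Exports.

Local Open Scope classical_set_scope.
Local Open Scope ring_scope.

Section TopologicalProperties.

Definition tychonoff_space (T : topologicalType) : Prop :=
  hausdorff_space T /\ completely_regular_space T.

Definition first_countable (T : topologicalType) : Prop :=
  forall x : T, exists U : nat -> set T,
    (forall n, nbhs x (U n)) /\
    (forall V, nbhs x V -> exists n, U n `<=` V).

Definition separable (T : topologicalType) : Prop :=
  exists2 D : set T, countable D & dense D.

(* [relatively_tychonoff Y T]: the space T is "Y-Tychonoff". *)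
Definition relatively_tychonoff (Y T : topologicalType) : Prop :=
  forall (A : set T) (x : T) (y z : Y), closed A -> ~ A x -> y <> z ->
    exists f : T -> Y,
      [/\ continuous f, f x = y & forall a, A a -> f a = z].

Definition is_metric (R : realType) (T : Type) (d : T -> T -> R) : Prop :=
  [/\ forall x, d x x = 0,
      forall x y, d x y = 0 -> x = y,
      forall x y, d x y = d y x &
      forall x y z, d x z <= d x y + d y z].

Definition induces_topology (R : realType) (T : topologicalType)
    (d : T -> T -> R) : Prop :=
  forall (x : T) (A : set T),
    nbhs x A <-> exists2 e : R, 0 < e & [set y | d x y < e] `<=` A.

Definition metric_cauchy (R : realType) (T : Type) (d : T -> T -> R)
    (u : nat -> T) : Prop :=
  forall e : R, 0 < e -> exists N : nat,
    forall m n : nat, (N <= m)%N -> (N <= n)%N -> d (u m) (u n) < e.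

Definition metrizable (R : realType) (T : topologicalType) : Prop :=
  exists d : T -> T -> R, is_metric d /\ induces_topology d.

Definition completely_metrizable (R : realType) (T : topologicalType) : Prop :=
  exists d : T -> T -> R, [/\ is_metric d, induces_topology d &
    forall u : nat -> T, metric_cauchy d u ->
      exists l : T, u n @[n --> \oo] --> l].

Definition polish (R : realType) (T : topologicalType) : Prop :=
  separable T /\ completely_metrizable R T.

Definition continuous_image (S T : topologicalType) : Prop :=
  exists2 f : S -> T, continuous f & range f = [set: T].

Definition cosmic (R : realType) (T : topologicalType) : Prop :=
  exists S : topologicalType,
    [/\ separable S, metrizable R S & continuous_image S T].

Definition analytic (R : realType) (T : topologicalType) : Prop :=
  exists2 S : topologicalType, polish R S & continuous_image S T.

Definition usco (S T : topologicalType) (F : S -> set T) : Prop :=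
  (forall s, compact (F s)) /\
  (forall s (U : set T), open U -> F s `<=` U -> \near s, F s `<=` U).

(* {ptws nat -> nat} is the Baire space: the product of discrete copies of
   nat. *)
Definition K_analytic (T : topologicalType) : Prop :=
  exists2 F : {ptws nat -> nat} -> set T, usco F &
    \bigcup_s F s = [set: T].

End TopologicalProperties.

Section BaireClasses.
Variables X Y : topologicalType.

Definition pointwise_limits (S : set (X -> Y)) : set (X -> Y) :=
  [set f | exists u : nat -> X -> Y,
     (forall n, S (u n)) /\ (forall x, u n x @[n --> \oo] --> f x)].

(* [baire_upto n] is the union of the Baire classes B_i for i <= n, so that
   B_(n+1) consists of the pointwise limits of sequences in [baire_upto n].
   Only the Baire classes of finite order are defined. *)
Fixpoint baire_upto (n : nat) : set (X -> Y) :=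
  if n is m.+1 then baire_upto m `|` pointwise_limits (baire_upto m)
  else [set f | continuous f].

Definition baire_class (n : nat) : set (X -> Y) :=
  if n is m.+1 then pointwise_limits (baire_upto m)
  else [set f | continuous f].

End BaireClasses.

(* A set H of functions, as a space with the topology of pointwise
   convergence. *)
Definition ptws_subspace (X : Type) (Y : topologicalType)
    (H : set (X -> Y)) : topologicalType :=
  set_type (H : set {ptws X -> Y}).

(* Precompactness in the sense of topological groups; the library's
   [precompact] is relative compactness of a subset. *)
Definition precompact_group (G : topologicalZmodType) : Prop :=
  forall U : set G, nbhs 0 U ->
    exists2 F : set G, finite_set F &
      \bigcup_(g in F) [set g + u | u in U] = [set: G].

Definition is_subgroup (V : zmodType) (H : set V) : Prop :=
  H 0 /\ forall f g, H f -> H g -> H (f - g).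

(* Main.v *)
Require Import Defs.
From HB Require Import structures.
From mathcomp Require Import all_boot all_order all_algebra.
From mathcomp Require Import all_classical all_reals all_analysis.
From mathcomp Require Import lra.

Set Implicit Arguments.
Unset Strict Implicit.
Unset Printing Implicit Defensive.

Import Order.TTheory GRing.Theory Num.Theory.

Local Open Scope classical_set_scope.
Local Open Scope ring_scope.

(** The proof starts from two facts about which functions [H] contains.

    Because [X] is first countable and [G]-Tychonoff, the function with value
    [g] at [x] and [0] elsewhere is a pointwise limit of continuous functions
    that vanish off smaller and smaller neighbourhoods of [x]
    ([point_fun_baire1]), so [H] contains it.  Because finite sets are closed,
    continuous functions interpolate arbitrary values on finite sets; if [X]
    is countable, every function is therefore of the first Baire class and
    [H] is the whole of [G^X] ([baire1_countable]).

    If [X] is infinite and [K] is a compact neighbourhood in [H], then [K]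
    restrains only finitely many coordinates, and the one-point functions at
    another point [y] show that [K] evaluates at [y] onto all of [G]; so [G]
    would be compact, hence precompact.  If [X] is finite, [H = G^X] and
    Tychonoff's theorem applies.

    For a fixed [g <> 0] the one-point functions form a discrete subspace
    indexed by [X], and a discrete subspace of a cosmic space is countable
    ([cosmic_discrete_family]); moreover [G] is an image of [H] under
    evaluation.  Conversely, for countable [X], an image [S -> G] gives an
    image [S^nat -> G^X = H], and [S^nat] inherits separability and a
    (complete) metric from [S].

    For K-analyticity: an analytic space is an image of the Baire space
    ([polish_baire_image]), hence K-analytic.  Conversely, if [H] is
    K-analytic, so is its image [G]; being metrizable, [G] is then analytic,
    since the graph of an usco map from the Baire space into a metric space is
    Polish ([usco_graph_polish]).  What remains is that [X] is countable
    ([K_analytic_sigma_countable]).  Since [G] is separable and not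
    precompact, it is an increasing union of proper open subsets [O_n].  For
    [x] in [X] and a finite sequence [p] of integers, record an [n] such that
    the values at [x] of all functions in the image of the cylinder [p] lie in
    [O_n], if there is one.  This codes each [x] by a sequence of countably
    many possible symbols.  If [X] were uncountable, some code would be
    approximated to every order by infinitely many others, hence by the codes
    of distinct points [a_n]; a function with value outside [O_n] at [a_n] and
    [0] off these points lies in [H], as it is of the second Baire class, but
    cannot belong to any of the compact sets that cover [H]. *)

(** * Pointwise convergence and subspaces *)

Lemma ptws_cvgP (I : choiceType) (T : topologicalType)
    (F : set_system {ptws I -> T}) (f : {ptws I -> T}) : Filter F ->
  F --> f <-> forall i, (fun g : {ptws I -> T} => g i) @ F --> f i.
Proof.
move=> FF; split=> [Ff i|Ff].
  apply: (cvg_trans _ (@proj_continuous I (fun=> T) i f)).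
  exact: (cvg_app (proj i) Ff).
apply/cvg_sup => i A [_ [[B oB <-] Bfi] sBA].
by apply: filterS sBA _; apply: (Ff i); exact: open_nbhs_nbhs.
Qed.

Lemma ptws_eval_continuous (I : choiceType) (T : topologicalType) (i : I) :
  continuous (fun g : {ptws I -> T} => g i).
Proof. exact: (@proj_continuous I (fun=> T)). Qed.

Lemma continuous_ptws (S : topologicalType) (I : choiceType)
    (T : topologicalType) (f : S -> {ptws I -> T}) :
  (forall i, continuous (fun s => f s i)) -> continuous f.
Proof. by move=> cf s; apply/ptws_cvgP => i; exact: cf. Qed.

Lemma ptws_nbhs_box (I : choiceType) (T : topologicalType)
    (f : {ptws I -> T}) (A : set {ptws I -> T}) : nbhs f A ->
  exists (D : set I) (U : I -> set T), [/\ finite_set D,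
    forall i, nbhs (f i) (U i) & [set g | forall i, D i -> U i (g i)] `<=` A].
Proof.
pose B := filter_from
  [set DU : set I * (I -> set T) |
    finite_set DU.1 /\ forall i, nbhs (f i) (DU.2 i)]
  (fun DU => [set g : {ptws I -> T} | forall i, DU.1 i -> DU.2 i (g i)]).
have FB : Filter B.
  apply: filter_from_filter.
    exists (set0, fun=> setT); split=> // i; exact: filterT.
  move=> [D U] [E V] /= [finD nU] [finE nV].
  exists (D `|` E, fun i => U i `&` V i).
    by split=> [|i] /=; [rewrite finite_setU|exact: filterI].
  by move=> g /= gDE; split=> i iD; have [] := gDE i; [left|..|right|].
suff : B --> f.
  by move=> Bf /Bf [[D U] [finD nU] sub]; exists D, U.
apply/ptws_cvgP => i A' nA'.
exists ([set i], fun j => if pselect (j = i) is left _ then A' else setT).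
  split=> //= j; case: pselect => [->//|_]; exact: filterT.
by move=> g /= /(_ i erefl); case: pselect.
Qed.

Lemma set_val_continuous (T : topologicalType) (A : set T) :
  continuous (set_val : A -> T).
Proof. exact: initial_continuous. Qed.

Lemma nbhs_set_typeP (T : topologicalType) (A : set T) (a : A) (U : set A) :
  nbhs a U <-> exists2 V, nbhs (set_val a) V & set_val @^-1` V `<=` U.
Proof.
split=> [[_ [[V oV <-] Va] VU]|[V nV VU]].
  by exists V => //; exact: open_nbhs_nbhs.
by apply: (filterS VU); exact: (@set_val_continuous T A a).
Qed.

Lemma continuous_set_type (S T : topologicalType) (A : set T) (f : S -> A) :
  continuous (fun s => set_val (f s)) -> continuous f.
Proof.
move=> cf s U /nbhs_set_typeP[V nV VU].
rewrite /nbhs /=.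
apply: (@filterS _ (nbhs s) _ (fun t => V (set_val (f t)))).
  by move=> t; exact: VU.
exact: (cf s V nV).
Qed.

Definition subspace_eval (X : Type) (G : topologicalType) (H : set (X -> G))
  (x : X) (h : ptws_subspace H) : G := (set_val h : X -> G) x.
Arguments subspace_eval {X G} H x h.

Lemma subspace_eval_continuous (X : choiceType) (G : topologicalType)
    (H : set (X -> G)) (x : X) : continuous (subspace_eval H x).
Proof.
move=> h.
apply: (@continuous_comp _ _ _ set_val (fun f : {ptws X -> G} => f x)).
  exact: set_val_continuous.
exact: ptws_eval_continuous.
Qed.

(** * Metrics and separability *)

Lemma exists_invn_lt (R : realType) (e : R) : 0 < e ->
  exists n : nat, n.+1%:R^-1 < e.
Proof. by move=> /ltr_add_invr[n]; rewrite add0r; exists n. Qed.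

Section metrics.
Context (R : realType) (T : topologicalType) (d : T -> T -> R).
Hypotheses (dm : is_metric d) (dt : induces_topology d).

Lemma metric_ge0 x y : 0 <= d x y.
Proof.
case: dm => d0 _ dC dT; have := dT x y x; rewrite d0 (dC y x) -mulr2n.
by rewrite pmulrn_lge0.
Qed.

Lemma nbhs_metric x e : 0 < e -> nbhs x [set y | d x y < e].
Proof. by move=> e0; apply/dt; exists e. Qed.

Lemma cvg_metricP (F : set_system T) x : Filter F ->
  F --> x <-> forall e, 0 < e -> F [set y | d x y < e].
Proof.
move=> FF; split=> [Fx e e0|Fx A /dt[e e0]]; first exact/Fx/nbhs_metric.
by move=> /filterS; apply; exact: Fx.
Qed.

Lemma metric_hausdorff : hausdorff_space T.
Proof.
case: (dm) => d0 d1 dC dT x y xy; apply: d1; apply/eqP.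
rewrite eq_le metric_ge0 andbT leNgt; apply/negP => dxy.
have e0 : 0 < d x y / 2 by rewrite divr_gt0.
have [z /= [xz yz]] := xy _ _ (nbhs_metric x e0) (nbhs_metric y e0).
have := dT x z y; rewrite leNgt => /negP; apply.
by rewrite (splitr (d x y)) ltrD // dC.
Qed.

End metrics.

(** Enumerating a dense set allows repetitions, so finite dense sets are
    included; the point [x0] serves as default value. *)
Lemma separable_enum (T : topologicalType) (x0 : T) : separable T <->
  exists e : nat -> T, forall (x : T) A, nbhs x A -> exists n, A (e n).
Proof.
split=> [[D cD dD]|[e de]].
  have [f finj] := countable_injP _ cD.
  exists (fun n => xget x0 [set x | D x /\ f x = n]) => x A nA.
  have [|z [Az Dz]] := dD (A°) _ (@open_interior _ A).
    by exists x; exact: nbhs_singleton (nbhs_interior nA).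
  exists (f z); rewrite (_ : xget _ _ = z); first exact: interior_subset.
  by apply: xget_unique => // y [Dy] /finj; apply; rewrite inE.
exists (range e); first exact: card_image_le.
move=> O [x Ox] oO; have [n On] := de x O (open_nbhs_nbhs (conj oO Ox)).
by exists (e n); split.
Qed.

Lemma separable_inhabited (T : topologicalType) :
  ([set: T] !=set0 -> separable T) -> separable T.
Proof.
have [T0 /(_ T0)//|T0 _] := pselect ([set: T] !=set0).
exists set0; first exact: countable0.
by move=> O [x _]; case: T0; exists x.
Qed.

Lemma separable_image (S T : topologicalType) :
  separable S -> continuous_image S T -> separable T.
Proof.
move=> [D cD dD] [f cf fT]; exists (f @` D).
  by apply: (@sub_countable _ _ _ D) => //; exact: card_image_le.
move=> O [y Oy] oO.
have [x _ fx] : range f y by rewrite fT.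
have [] := dD (f @^-1` O); first by exists x; rewrite /= fx.
  by apply: open_comp => // z _; exact: cf.
by move=> z [/= Oz Dz]; exists (f z); split => //; exists z.
Qed.

Lemma continuous_image_trans (S T U : topologicalType) :
  continuous_image S T -> continuous_image T U -> continuous_image S U.
Proof.
move=> [f cf fT] [g cg gT]; exists (g \o f).
  by move=> s; apply: continuous_comp; [exact: cf|exact: cg].
apply/seteqP; split=> // u _.
have [t _ <-] : range g u by rewrite gT.
by have [s _ <-] : range f t by [rewrite fT]; exists s.
Qed.

Lemma continuous_image_refl (S : topologicalType) : continuous_image S S.
Proof. by exists id => //; [move=> s|rewrite image_id]. Qed.

Section sequence_space.
Context (R : realType) (T : topologicalType) (d : T -> T -> R).
Hypotheses (dm : is_metric d) (dt : induces_topology d).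
Local Notation Tw := {ptws nat -> T}.

(** A supremum rather than a sum: each coordinate is bounded by [1/(n+1)], so
    that the metric restricts the coordinate [n] only at scales below it. *)
Definition seq_metric (u v : Tw) : R :=
  sup (range (fun n => Num.min (d (u n) (v n)) n.+1%:R^-1)).

Lemma invS_le1 n : n.+1%:R^-1 <= 1 :> R.
Proof. by rewrite invf_le1 // ler1n. Qed.

Lemma seq_metric_ge u v n :
  Num.min (d (u n) (v n)) n.+1%:R^-1 <= seq_metric u v.
Proof.
apply: ub_le_sup; last by exists n.
by exists 1 => _ [m _ <-]; rewrite ge_min invS_le1 orbT.
Qed.

Lemma seq_metric_le u v e :
  (forall n, Num.min (d (u n) (v n)) n.+1%:R^-1 <= e) -> seq_metric u v <= e.
Proof.
move=> uve; apply: ge_sup; last by move=> _ [n _ <-].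
by exists (Num.min (d (u 0) (v 0)) 1%:R^-1), 0.
Qed.

Lemma seq_metric_coord u v n e :
  e <= n.+1%:R^-1 -> seq_metric u v < e -> d (u n) (v n) < e.
Proof.
move=> en /(le_lt_trans (seq_metric_ge u v n)); rewrite gt_min => /orP[//|].
by rewrite ltNge en.
Qed.

Lemma seq_metric_le_prefix u v e N : 0 < e -> N.+1%:R^-1 <= e ->
  (forall n, (n <= N)%N -> d (u n) (v n) <= e) -> seq_metric u v <= e.
Proof.
move=> e0 Ne h; apply: seq_metric_le => n; rewrite ge_min.
have [/h->//|Nn] := leqP n N; apply/orP; right; apply: le_trans Ne.
by rewrite lef_pV2 ?posrE // ler_nat ltnW.
Qed.

Lemma seq_metric_is_metric : is_metric seq_metric.
Proof.
have dge0 := metric_ge0 dm.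
case: (dm) => d0 d1 dC dT; split.
- move=> u; apply/eqP; rewrite eq_le; apply/andP; split.
    by apply: seq_metric_le => n; rewrite d0 ge_min lexx.
  apply: le_trans (seq_metric_ge u u 0%N).
  by rewrite d0 le_min lexx /= invr_ge0.
- move=> u v uv; apply/funext => n; apply: d1; apply/eqP.
  rewrite eq_le dge0 andbT; have := seq_metric_ge u v n.
  by rewrite uv ge_min => /orP[//|h]; move: h; rewrite invr_le0 lern0.
- by move=> u v; rewrite /seq_metric; under eq_fun do rewrite dC.
- move=> u v w; apply: seq_metric_le => n.
  apply: le_trans (lerD (seq_metric_ge u v n) (seq_metric_ge v w n)).
  have := dT (u n) (v n) (w n).
  have := dge0 (u n) (v n); have := dge0 (v n) (w n).
  have : 0 <= n.+1%:R^-1 :> R by rewrite invr_ge0.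
  move: (n.+1%:R^-1 : R) (d (u n) (v n)) (d (v n) (w n)) (d (u n) (w n)).
  move=> a b c e a0 c0 b0 ebc.
  rewrite /Num.min; case: ifP; case: ifP; case: ifP => *; lra.
Qed.

Lemma seq_metric_induces : induces_topology seq_metric.
Proof.
case: (seq_metric_is_metric) => s0 s1 sC sT u A; split; last first.
  move=> [e e0 /filterS]; apply.
  have e20 : 0 < e / 2 by rewrite divr_gt0.
  have [N Ne] := exists_invn_lt e20.
  have FF : Filter (nbhs u) := nbhs_filter u.
  have : nbhs u [set v : Tw | forall n : 'I_N.+1, d (u n) (v n) < e / 2].
    apply: (@filter_forall Tw 'I_N.+1
      (fun n => [set v : Tw | d (u n) (v n) < e / 2]) (nbhs u) FF) => n.
    exact: (@ptws_eval_continuous nat T n u _ (nbhs_metric dt (u n) e20)).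
  apply: filterS => v uv.
  apply: (@le_lt_trans _ _ (e / 2)); last by rewrite gtr_pMr ?invf_lt1 ?ltr1n.
  apply: (@seq_metric_le_prefix _ _ _ N) => //; first exact: ltW.
  by move=> n nN; apply/ltW; exact: (uv (Ordinal (nN : (n < N.+1)%N))).
pose B := filter_from [set e : R | 0 < e]
  (fun e => [set v | seq_metric u v < e]).
have FB : Filter B.
  apply: filter_from_filter; first by exists 1 => /=.
  move=> e f /= e0 f0; exists (Num.min e f); first by rewrite /= lt_min e0.
  by move=> v /=; rewrite lt_min => /andP.
suff : B --> u by move=> /[apply].
apply/ptws_cvgP => n; apply/(cvg_metricP dt) => e e0.
exists (Num.min e n.+1%:R^-1); first by rewrite /= lt_min e0 invr_gt0 ltr0n.
move=> v /= /(@seq_metric_coord _ _ n).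
by rewrite ge_min lexx orbT lt_min => /(_ isT)/andP[].
Qed.

(** A Cauchy sequence is Cauchy in each coordinate, and its coordinatewise
    limit is a limit in the product topology. *)
Lemma seq_metric_complete :
  (forall u, metric_cauchy d u -> exists l : T, u n @[n --> \oo] --> l) ->
  forall u, metric_cauchy seq_metric u ->
    exists l : Tw, u n @[n --> \oo] --> l.
Proof.
move=> dc u uc.
have /choice[l lP] : forall k, exists l : T, u n k @[n --> \oo] --> l.
  move=> k; apply: dc => e e0.
  have [|N uN] := uc (Num.min e k.+1%:R^-1).
    by rewrite lt_min e0 invr_gt0 ltr0n.
  exists N => m n Nm Nn.
  have := @seq_metric_coord _ _ k _ _ (uN m n Nm Nn).
  by rewrite ge_min lexx orbT lt_min => /(_ isT)/andP[].
by exists l; apply/ptws_cvgP.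
Qed.

(** Sequences following the enumeration of a dense set along a finite list of
    indices and constant afterwards are dense. *)
Lemma seq_separable : separable T -> separable Tw.
Proof.
move=> sT; apply: separable_inhabited => -[u0 _].
have [e de] := (separable_enum (u0 0%N)).1 sT; apply/(@separable_enum Tw u0).
pose z (t : seq nat) : Tw := fun n => e (nth 0%N t n).
exists (fun n => z (odflt [::] (unpickle n))).
move=> u A /seq_metric_induces[r r0 rA].
have r20 : 0 < r / 2 by rewrite divr_gt0.
have [N Ne] := exists_invn_lt r20.
have /choice[k kP] : forall n, exists k, d (u n) (e k) < r / 2.
  by move=> n; exact: (de _ _ (nbhs_metric dt (u n) r20)).
exists (pickle (mkseq k N.+1)); rewrite pickleK /=; apply: rA => /=.
apply: (@le_lt_trans _ _ (r / 2)); last by rewrite gtr_pMr ?invf_lt1 ?ltr1n.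
apply: (@seq_metric_le_prefix _ _ _ N) => //; first exact: ltW.
by move=> n nN; apply/ltW; rewrite /z nth_mkseq.
Qed.

End sequence_space.

(** Covering compactness in terms of neighbourhoods indexed by the points of
    the compact set; the filter of all lists containing a given list turns
    near-coverings into finite subcovers. *)
Lemma compact_finite_subcover (T : topologicalType) (K : set T)
    (V : T -> set T) :
  compact K -> (forall x, K x -> nbhs x (V x)) ->
  exists l : seq T, forall y, K y -> exists c, [/\ c \in l, K c & V c y].
Proof.
move=> /compact_near_coveringP cK nV.
pose F := filter_from [set: seq T]
  (fun l => [set l' : seq T | {subset l <= l'}]).
have FF : ProperFilter F.
  apply: filter_from_proper; last by move=> l _; exists l.
  apply: filter_from_filter; first by exists [::].
  move=> l l' _ _; exists (l ++ l') => // m lm.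
  by split=> x xl; apply: lm; rewrite mem_cat xl ?orbT.
pose P (l : seq T) y := exists c, [/\ c \in l, K c & V c y].
have /filter_ex[l lP] : \forall l \near F, K `<=` P l.
  apply: cK => x Kx; exists (V x, [set l | x \in l]).
    split => /=; first exact: nV.
    by exists [:: x] => // l /= /(_ x); rewrite mem_head; exact.
  by move=> [y l] /= [Vy xl]; exists x.
by exists l => y /lP.
Qed.

Lemma compact_sub_increasing (T : topologicalType) (K : set T)
    (O : nat -> set T) :
  (forall m n, (m <= n)%N -> O m `<=` O n) -> (forall n, open (O n)) ->
  K `<=` \bigcup_n O n -> compact K -> exists n, K `<=` O n.
Proof.
move=> incO oO KO cK.
have /choice[k kP] : forall y, exists k, K y -> O k y.
  move=> y; have [/KO[k _ Oy]|nK] := pselect (K y); first by exists k.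
  by exists 0%N.
have [|l lP] := compact_finite_subcover (V := fun x => O (k x)) cK.
  by move=> x Kx; apply: open_nbhs_nbhs; split => //; exact: kP.
exists (\max_(c <- l) k c) => y /lP[c [cl _]]; apply: incO.
exact: leq_bigmax_seq.
Qed.

Section metric_subspaces.
Context (R : realType) (T : topologicalType) (d : T -> T -> R).
Hypotheses (dm : is_metric d) (dt : induces_topology d).

Lemma open_metric_ball x e : open [set y | d x y < e].
Proof.
case: dm => d0 _ dC dT; rewrite openE => y /= xy.
apply/dt; exists (e - d x y); first by rewrite subr_gt0.
by move=> z /=; rewrite ltrBrDl; apply: le_lt_trans; exact: dT.
Qed.

Lemma dense_seq_approx (e : nat -> T) x r :
  (forall (x : T) A, nbhs x A -> exists n, A (e n)) -> 0 < r ->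
  exists n, d (e n) x < r.
Proof.
case: dm => d0 _ dC dT de r0; have [n] := de _ _ (nbhs_metric dt x r0).
by exists n; rewrite dC.
Qed.

Lemma sub_is_metric (A : set T) :
  is_metric (fun a b : A => d (set_val a) (set_val b)).
Proof.
case: dm => d0 d1 dC dT; split => [x|x y /d1|x y|x y z].
- exact: d0.
- exact: val_inj.
- exact: dC.
- exact: dT.
Qed.

Lemma sub_induces_topology (A : set T) :
  induces_topology (fun a b : A => d (set_val a) (set_val b)).
Proof.
move=> a U; split=> [/nbhs_set_typeP[V /dt[e e0 eV] VU]|[e e0 eU]].
  by exists e => // b /= ab; apply: VU; exact: eV.
apply/nbhs_set_typeP; exists [set y | d (set_val a) y < e] => //.
exact: nbhs_metric.
Qed.

Lemma sub_separable (A : set T) : separable T -> separable (set_type A).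
Proof.
case: dm => d0 _ dC dT.
move=> sT; apply: separable_inhabited => -[a0 _].
have [e de] := (separable_enum (set_val a0)).1 sT; apply/(separable_enum a0).
(* the n-th point of e need not lie in A: a point of A at distance less than
   1/(k+1) from it is chosen for every k for which there is one *)
pose z (p : nat * nat) :=
  xget a0 [set a : A | d (e p.1) (set_val a) < p.2.+1%:R^-1].
exists (fun n => z (odflt (0, 0)%N (unpickle n))).
move=> a U /sub_induces_topology[r r0 rU].
have r20 : 0 < r / 2 by rewrite divr_gt0.
have [k ke] := exists_invn_lt r20.
have k0 : 0 < k.+1%:R^-1 :> R by rewrite invr_gt0.
have [n na] := dense_seq_approx (set_val a) de k0.
exists (pickle (n, k)); rewrite pickleK; apply: rU.
suff : d (set_val a) (set_val (z (n, k))) < r by [].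
have zk : d (e n) (set_val (z (n, k))) < k.+1%:R^-1.
  apply: (@xgetPex _ a0 [set a : A | d (e n) (set_val a) < k.+1%:R^-1]).
  by exists a.
have := dT (set_val a) (e n) (set_val (z (n, k))); rewrite (dC _ (e n)).
move=> /le_lt_trans; apply; rewrite (splitr r) ltrD //; exact: lt_trans ke.
Qed.

End metric_subspaces.

Section prod_metric.
Context (R : realType) (S T : topologicalType).
Context (d : S -> S -> R) (d' : T -> T -> R).
Hypotheses (dm : is_metric d) (dt : induces_topology d).
Hypotheses (d'm : is_metric d') (d't : induces_topology d').

Definition prod_metric (x y : S * T) : R := d x.1 y.1 + d' x.2 y.2.

Lemma prod_is_metric : is_metric prod_metric.
Proof.
have dge := metric_ge0 dm; have dge' := metric_ge0 d'm.
case: dm => d0 d1 dC dT; case: d'm => d0' d1' dC' dT'; split.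
- by move=> x; rewrite /prod_metric d0 d0' addr0.
- move=> [x x'] [y y'] /eqP; rewrite /prod_metric paddr_eq0 //=.
  by move=> /andP[/eqP/d1 -> /eqP/d1' ->].
- by move=> x y; rewrite /prod_metric dC dC'.
- by move=> x y z; rewrite /prod_metric addrACA lerD.
Qed.

Lemma prod_induces_topology : induces_topology prod_metric.
Proof.
have dge := metric_ge0 dm; have dge' := metric_ge0 d'm.
move=> x A; split=> [[[U V] /= [/dt[e e0 eU] /d't[f f0 fV]] UVA]|[e e0 eA]].
  exists (Num.min e f); first by rewrite lt_min e0.
  move=> y /=; rewrite lt_min /prod_metric => /andP[ye yf]; apply: UVA.
  have := dge x.1 y.1; have := dge' x.2 y.2 => h1 h2.
  by split => /=; [apply: eU|apply: fV] => /=; lra.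
have e20 : 0 < e / 2 by rewrite divr_gt0.
exists ([set y | d x.1 y < e / 2], [set y | d' x.2 y < e / 2]).
  by split; [exact: (nbhs_metric dt)|exact: (nbhs_metric d't)].
by move=> y /= [y1 y2]; apply: eA => /=; rewrite /prod_metric; lra.
Qed.

Lemma prod_separable : separable S -> separable T -> separable (S * T)%type.
Proof.
move=> sS sT; apply: separable_inhabited => -[[x0 y0] _].
have [e de] := (separable_enum x0).1 sS.
have [f df] := (separable_enum y0).1 sT.
apply/(separable_enum (x0, y0)).
pose z (p : nat * nat) := (e p.1, f p.2).
exists (fun n => z (odflt (0, 0)%N (unpickle n))).
move=> [x y] A [[U V] /= [nU nV]] UVA.
have [n Un] := de _ _ nU; have [k Vk] := df _ _ nV.
by exists (pickle (n, k)); rewrite pickleK; exact: UVA.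
Qed.

End prod_metric.

(** Lift the family along a continuous surjection from a separable metrizable
    space, and send each index to a basic ball that separates its lift from
    all the others. *)
Lemma cosmic_discrete_family (R : realType) (T : topologicalType)
    (I : choiceType) (f : I -> T) (W : I -> set T) : cosmic R T ->
  (forall i, open (W i)) -> (forall i, W i (f i)) ->
  (forall i j, W i (f j) -> i = j) -> countable [set: I].
Proof.
move=> [S [sepS [d [dm dt]] [q cq qT]]] oW Wf Winj.
have [[i0 _]|/set0P/negP/negPn/eqP ->] := pselect ([set: I] !=set0);
  last exact: countable0.
have /choice[s sP] : forall i, exists s, q s = f i.
  by move=> i; have [s _ <-] : range q (f i) by [rewrite qT]; exists s.
have [e de] := (separable_enum (s i0)).1 sepS.
have /choice[c cP] : forall i, exists c : nat * nat,
    d (e c.1) (s i) < c.2.+1%:R^-1 /\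
    forall t, d (e c.1) t < c.2.+1%:R^-1 -> W i (q t).
  move=> i; have : nbhs (s i) (q @^-1` W i).
    by apply: (cq (s i)); apply: open_nbhs_nbhs; split=> //; rewrite sP.
  move=> /dt[r r0 rW]; have r20 : 0 < r / 2 by rewrite divr_gt0.
  have [k kr] := exists_invn_lt r20.
  have k0 : 0 < k.+1%:R^-1 :> R by rewrite invr_gt0.
  have [n nk] := dense_seq_approx dm dt (s i) de k0.
  exists (n, k); split => //= t nt; apply: rW => /=.
  case: (dm) => d0 _ dC dT; apply: le_lt_trans (dT _ (e n) _) _.
  rewrite (splitr r) (dC (s i)) ltrD //; exact: lt_trans kr.
apply/countable_injP; exists (fun i => pickle (c i)).
move=> i j _ _ /(pcan_inj pickleK) cij.
by apply: Winj; rewrite -sP; apply: (cP i).2; rewrite cij; exact: (cP j).1.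
Qed.

(** Countable powers of [T] are images of the sequence space over [S]; the
    point [s0] fills the coordinates that do not index anything. *)
Lemma seq_image_ptws (S T : topologicalType) (I : choiceType) (s0 : S) :
  countable [set: I] -> continuous_image S T ->
  continuous_image {ptws nat -> S} {ptws I -> T}.
Proof.
move=> /countable_injP[c cinj] [q cq qT].
exists (fun w i => q (w (c i))).
  apply: continuous_ptws => i w.
  apply: (@continuous_comp _ _ _ (fun w : {ptws nat -> S} => w (c i)) q).
    exact: ptws_eval_continuous.
  exact: cq.
apply/seteqP; split=> // f _.
have /choice[p pP] : forall t, exists s, q s = t.
  by move=> t; have [s _ <-] : range q t by [rewrite qT]; exists s.
exists (fun n => if pselect (exists i, c i = n) is left cn
  then p (f (projT1 (cid cn))) else s0) => //.
apply/funext => i; case: pselect => [ci|[]]; last by exists i.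
rewrite pP; congr (f _); apply: cinj; rewrite ?inE //.
exact: (projT2 (cid ci)).
Qed.

Lemma polish_seq (R : realType) (S : topologicalType) :
  polish R S -> polish R {ptws nat -> S}.
Proof.
move=> [sS [d [dm dt dc]]]; split; first exact: (seq_separable dm dt).
exists (seq_metric d); split.
- exact: seq_metric_is_metric.
- exact: seq_metric_induces.
- exact: seq_metric_complete.
Qed.

(** * The Baire space and analytic spaces *)

Lemma filter_forall_mem (T : Type) (I : eqType) (F : set_system T) (l : seq I)
    (P : I -> set T) : Filter F ->
  (forall c, c \in l -> F (P c)) -> F [set x | forall c, c \in l -> P c x].
Proof.
move=> FF; elim: l => [_|c l IH FP]; first exact: filterE.
have Fc := FP c (mem_head _ _).
have Fl : F [set x | forall c, c \in l -> P c x].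
  by apply: IH => c' cl; apply: FP; rewrite in_cons cl orbT.
apply: filterS (filterI Fc Fl) => x [Pc Pl] c'.
by rewrite in_cons => /orP[/eqP ->//|]; exact: Pl.
Qed.

Lemma nbhs_nat (n : nat) (A : set nat) : A n -> nbhs n A.
Proof. by move=> An; apply/principal_filterP. Qed.

Local Notation NN := {ptws nat -> nat}.

Definition prefix_cylinder (N : nat) (s : NN) : set NN :=
  [set t | forall i, (i < N)%N -> t i = s i].

(** Cylinders over finite prefixes form a countable family, which is what
    makes compact-valued maps on the Baire space behave like countable
    objects. *)
Lemma NN_nbhsP (s : NN) (A : set NN) :
  nbhs s A <-> exists N, prefix_cylinder N s `<=` A.
Proof.
split=> [/ptws_nbhs_box[D [U [finD nU DU]]]|[N NA]].
  have /finite_seqP[l lD] := finD.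
  exists (\max_(i <- l) i).+1 => t ts; apply: DU => i Di.
  rewrite ts; first exact: nbhs_singleton.
  by rewrite ltnS; apply: leq_bigmax_seq => //; move: Di; rewrite lD.
have FF : Filter (nbhs s) := nbhs_filter s.
have sN : nbhs s [set t : NN | forall i : 'I_N, t i = s i].
  apply: (@filter_forall NN 'I_N
    (fun i => [set t : NN | t i = s i]) (nbhs s) FF) => i.
  apply: (@ptws_eval_continuous nat nat i s [set m | m = s i]).
  exact: nbhs_nat.
by apply: filterS sN => t ts; apply: NA => i iN; exact: (ts (Ordinal iN)).
Qed.

Section nat_metric.
Context (R : realType).

Definition nat_metric (m n : nat) : R := (m != n)%:R.

Lemma nat_metric_lt1 m n e : e <= 1 -> nat_metric m n < e -> m = n.
Proof.
rewrite /nat_metric => e1; have [//|_] := eqVneq m n.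
by rewrite ltNge e1.
Qed.

Lemma polish_nat : polish R nat.
Proof.
have dt : induces_topology nat_metric.
  move=> n A; split=> [/nbhs_singleton An|[e e0 eA]].
    by exists 1 => // m /nat_metric_lt1 <-.
  by apply: nbhs_nat; apply: eA; rewrite /= /nat_metric eqxx.
split.
  apply/(separable_enum 0%N); exists id => n A /nbhs_singleton An.
  by exists n.
exists nat_metric; split=> //.
  rewrite /nat_metric; split=> [n|m n|m n|m n p].
  - by rewrite eqxx.
  - by have [//|_ /eqP] := eqVneq m n; rewrite oner_eq0.
  - by rewrite eq_sym.
  - by rewrite -natrD ler_nat; have [->|_] := eqVneq m n; last case: (m != p).
move=> u /(_ 1 ltr01)[N uN]; exists (u N) => A /nbhs_singleton An.
by exists N => // n /= Nn; rewrite -(@nat_metric_lt1 (u N) (u n) 1) ?uN.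
Qed.

End nat_metric.

Section polish_image.
Context (R : realType) (S : topologicalType) (d : S -> S -> R).
Hypotheses (dm : is_metric d) (dt : induces_topology d).
Hypothesis dc : forall u : nat -> S, metric_cauchy d u ->
  exists l : S, u n @[n --> \oo] --> l.
Variable e : nat -> S.
Hypothesis de : forall (x : S) A, nbhs x A -> exists n, A (e n).

Let halfpow (n : nat) : R := 2^-1 ^+ n.

Lemma halfpow_gt0 n : 0 < halfpow n. Proof. by rewrite exprn_gt0. Qed.

Lemma halfpowS n : halfpow n = 2 * halfpow n.+1.
Proof. by rewrite /halfpow exprS mulrA divff ?mul1r. Qed.

Lemma halfpow_lt r : 0 < r -> exists n, halfpow n < r.
Proof.
move=> /exists_invn_lt[n nr]; exists n; apply: le_lt_trans nr.
by rewrite /halfpow exprVn lef_pV2 ?posrE ?exprn_gt0 // -natrX ler_nat ltn_expl.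
Qed.

(** The [n]-th step moves to the dense point named by the coordinate [n] only
    if it is within [2^-n]; so every sequence, without restriction, yields a
    Cauchy sequence with a uniform rate. *)
Fixpoint baire_approx (s : NN) (n : nat) : S :=
  if n is m.+1 then
    let p := baire_approx s m in
    if d p (e (s m.+1)) < halfpow m then e (s m.+1) else p
  else e (s 0%N).

Lemma baire_approx_step s n :
  d (baire_approx s n) (baire_approx s n.+1) <= halfpow n.
Proof.
rewrite /=; case: ifP => [/ltW//|_].
by case: dm => -> _ _ _; exact: ltW (halfpow_gt0 n).
Qed.

Lemma baire_approx_dist s n k :
  d (baire_approx s n) (baire_approx s (n + k)) <=
  2 * halfpow n - 2 * halfpow (n + k).
Proof.
case: (dm) => d0 _ dC dT.
elim: k => [|k IH]; first by rewrite addn0 d0 subrr.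
rewrite addnS; apply: le_trans (dT _ (baire_approx s (n + k)) _) _.
have := baire_approx_step s (n + k); rewrite -(halfpowS (n + k)).
have := halfpowS (n + k); move: IH; lra.
Qed.

Lemma baire_approx_le s n m : (n <= m)%N ->
  d (baire_approx s n) (baire_approx s m) <= 2 * halfpow n.
Proof.
move=> /subnKC <-; apply: le_trans (baire_approx_dist _ _ _) _.
by rewrite gerBl mulr_ge0 // ltW ?halfpow_gt0.
Qed.

Lemma baire_approx_cauchy s : metric_cauchy d (baire_approx s).
Proof.
case: (dm) => d0 _ dC dT r r0.
have /halfpow_lt[N Nr] : 0 < r / 4 by rewrite divr_gt0.
exists N => m n Nm Nn; apply: le_lt_trans (dT _ (baire_approx s N) _) _.
rewrite (dC _ (baire_approx s N)).
have := baire_approx_le s Nm; have := baire_approx_le s Nn; lra.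
Qed.

Lemma baire_approx_prefix s t n : (forall i, (i <= n)%N -> t i = s i) ->
  baire_approx t n = baire_approx s n.
Proof.
elim: n => [|n IH] st /=; first by rewrite st.
rewrite IH ?st // => i ni; apply: st; exact: leqW.
Qed.

(** The limit map is continuous because a prefix determines an approximation
    with a uniform error bound; it is onto because a sequence of indices of
    dense points converging fast enough to [y] is never rejected. *)
Lemma polish_baire_image : continuous_image NN S.
Proof.
case: (dm) => d0 _ dC dT.
have /choice[f fP] : forall s, exists l : S,
    baire_approx s n @[n --> \oo] --> l.
  by move=> s; apply: dc; exact: baire_approx_cauchy.
have f_le s n : d (baire_approx s n) (f s) <= 2 * halfpow n.
  apply/ler_addgt0Pr => r r0.
  have [N _ NP] := (cvg_metricP dt _ _).1 (fP s) r r0.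
  have /= := NP (maxn N n) (leq_maxl _ _); rewrite dC => fr.
  apply: le_trans (dT _ (baire_approx s (maxn N n)) _) _.
  by rewrite lerD ?(ltW fr) // baire_approx_le ?leq_maxr.
exists f.
  move=> s A /dt[r r0 rA].
  have /halfpow_lt[N Nr] : 0 < r / 4 by rewrite divr_gt0.
  apply/NN_nbhsP; exists N.+1 => t st; apply: rA => /=.
  have := f_le s N; have := f_le t N; rewrite (@baire_approx_prefix s t) //.
  have := dT (f s) (baire_approx s N) (f t).
  rewrite (dC (f s) (baire_approx s N)); lra.
apply/seteqP; split=> // y _.
have quarter_gt0 n : 0 < halfpow n / 4 by rewrite divr_gt0 ?halfpow_gt0.
(* 1/4 leaves room for the step test: 2^-n / 4 + 2^-(n+1) / 4 < 2^-n *)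
have /choice[s sP] : forall n, exists k, d (e k) y < halfpow n / 4.
  by move=> n; exact: (dense_seq_approx dm dt).
have ss n : baire_approx s n = e (s n).
  elim: n => //= n ->; case: ifP => // /negbT /negP[].
  apply: le_lt_trans (dT _ y _) _; rewrite (dC y).
  have := sP n; have := sP n.+1; have := halfpowS n; have := halfpow_gt0 n; lra.
exists s => //.
case: (dm) => _ d1 _ _; apply: d1; apply/eqP.
rewrite eq_le (metric_ge0 dm) andbT; apply/ler_addgt0Pr => r r0; rewrite add0r.
have /halfpow_lt[N Nr] : 0 < r / 4 by rewrite divr_gt0.
apply: le_trans (dT _ (baire_approx s N) _) _; rewrite (dC (f s)).
have := f_le s N; have := sP N; rewrite ss; have := halfpow_gt0 N; lra.
Qed.

End polish_image.

Lemma analytic_baire_image (R : realType) (T : topologicalType) (t0 : T) :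
  analytic R T -> continuous_image NN T.
Proof.
move=> [S [sS [d [dm dt dc]]] [f cf fT]].
have [s0 _ _] : range f t0 by rewrite fT.
have [e de] := (separable_enum s0).1 sS.
apply: (@continuous_image_trans _ S); last by exists f.
exact: (polish_baire_image dm dt dc de).
Qed.

Lemma analytic_K_analytic (R : realType) (T : topologicalType) (t0 : T) :
  analytic R T -> K_analytic T.
Proof.
move=> /(analytic_baire_image t0)[f cf fT]; exists (fun s => [set f s]).
  split=> [s|s U oU /(_ _ erefl) Uf]; first exact: compact_set1.
  have : nbhs s (f @^-1` U) by apply: (cf s); exact: open_nbhs_nbhs.
  by apply: filterS => t Ut _ ->.
apply/seteqP; split=> // t _; have [s _ <-] : range f t by rewrite fT.
by exists s.
Qed.

Lemma K_analytic_image (S T : topologicalType) :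
  K_analytic S -> continuous_image S T -> K_analytic T.
Proof.
move=> [F [cF uF] FS] [f cf fT]; exists (fun s => f @` F s).
  split=> [s|s U oU FU].
    apply: continuous_compact (cF s); exact: continuous_subspaceT.
  have oU' : open (f @^-1` U) by apply: open_comp => // x _; exact: cf.
  have := uF s _ oU' (fun x Fx => FU _ (imageP f Fx)).
  by apply: filterS => t FtU _ [x /FtU Ux <-].
apply/seteqP; split=> // t _; have [x _ <-] : range f t by rewrite fT.
have [s _ Fx] : (\bigcup_s F s) x by rewrite FS.
by exists s => //; exists x.
Qed.

Section K_analytic_metrizable.
Context (R : realType) (T : topologicalType) (d : T -> T -> R).
Hypotheses (dm : is_metric d) (dt : induces_topology d).
Variable F : NN -> set T.
Hypotheses (uF : usco F) (FT : \bigcup_s F s = [set: T]).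

(** By upper semicontinuity, the whole image of a cylinder around [s] is
    covered by the finitely many balls of a given radius that cover [F s]; as
    there are countably many cylinders, the centres form a countable dense
    set. *)
Lemma usco_metrizable_separable : separable T.
Proof.
case: (dm) => d0 _ dC dT; case: (uF) => cF oF.
apply: separable_inhabited => -[x0 _].
pose net (p : seq nat * nat) (l : seq T) := forall t : NN,
  (forall i, (i < size p.1)%N -> t i = nth 0%N p.1 i) ->
  forall y, F t y -> exists2 c, c \in l & d c y < p.2.+1%:R^-1.
pose l p := xget [::] (net p).
pose e (q : (seq nat * nat) * nat) := nth x0 (l q.1) q.2.
apply/(separable_enum x0).
exists (fun n => e (odflt ([::], 0, 0)%N (unpickle n))).
move=> y A /dt[r r0 rA].
have [k kr] := exists_invn_lt r0.
have k0 : 0 < k.+1%:R^-1 :> R by rewrite invr_gt0.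
have [s _ Fsy] : (\bigcup_s F s) y by rewrite FT.
have [|l0 l0P] := compact_finite_subcover
    (V := fun x => [set y | d x y < k.+1%:R^-1]) (cF s).
  by move=> x _; exact: nbhs_metric.
have /NN_nbhsP[N Ns] : nbhs s [set t | F t `<=`
    \bigcup_(c in [set` l0]) [set y | d c y < k.+1%:R^-1]].
  apply: oF; first by apply: bigcup_open => c _; exact: open_metric_ball.
  by move=> z /l0P[c [cl _ cz]]; exists c.
have : net (mkseq s N, k) (l (mkseq s N, k)).
  apply: xgetPex; exists l0 => t /=; rewrite size_mkseq => ts z Ftz.
  have [|c /= cl cz] := Ns t _ z Ftz; last by exists c.
  by move=> i iN; rewrite ts // nth_mkseq.
move=> /(_ s _ y Fsy)[|c cl cy].
  by rewrite /= size_mkseq => i iN; rewrite nth_mkseq.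
exists (pickle ((mkseq s N, k), index c (l (mkseq s N, k)))).
rewrite pickleK /e /= nth_index //; apply: rA; rewrite /= dC.
exact: lt_trans cy kr.
Qed.

Definition usco_graph : set (NN * T) := [set z | F z.1 z.2].

(** The metric of the product is already complete on the graph, whether or not
    that of [T] is.  For a Cauchy sequence of points [(s_n, y_n)] of the
    graph, [s_n] converges to some [s0].  If [y_n] had no limit in [F s0],
    then, being Cauchy, it would eventually keep away from each point of
    [F s0], hence by compactness from a neighbourhood of [F s0]; this
    contradicts upper semicontinuity at [s0]. *)
Lemma usco_graph_polish : polish R (set_type usco_graph).
Proof.
case: (dm) => d0 _ dC dT; case: (uF) => cF oF.
have [sNN [D [Dm Dt Dc]]] := polish_seq (polish_nat R).
have Pm := prod_is_metric Dm dm; have Pt := prod_induces_topology Dm Dt dm dt.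
split.
  apply: (sub_separable Pm Pt).
  exact: prod_separable sNN usco_metrizable_separable.
exists (fun a b : usco_graph => prod_metric D d (set_val a) (set_val b)).
split; [exact: sub_is_metric|exact: sub_induces_topology|].
move=> u uc.
pose s n : NN := (set_val (u n)).1; pose y n : T := (set_val (u n)).2.
have Fsy n : F (s n) (y n) by have := set_valP (u n).
have [s0 ss0] : exists s0 : NN, s n @[n --> \oo] --> s0.
  apply: Dc => e e0; have [N NP] := uc e e0; exists N => m n Nm Nn.
  by apply: le_lt_trans (NP m n Nm Nn); rewrite lerDl (metric_ge0 dm).
have yc : metric_cauchy d y.
  move=> e e0; have [N NP] := uc e e0; exists N => m n Nm Nn.
  by apply: le_lt_trans (NP m n Nm Nn); rewrite lerDr (metric_ge0 Dm).
have [y0 Fy0 yy0] : exists2 y0, F s0 y0 & y n @[n --> \oo] --> y0.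
  apply: contrapT => noy.
  have /choice[r rP] : forall c, exists r, F s0 c ->
      0 < r /\ \forall n \near \oo, r <= d c (y n).
    move=> c; have [Fc|nFc] := pselect (F s0 c); last by exists 0.
    have : ~ (y n @[n --> \oo] --> c) by move=> yc0; apply: noy; exists c.
    move=> /(cvg_metricP dt _ _) /existsNP[e /not_implyP[e0 ne]].
    have e20 : 0 < e / 2 by rewrite divr_gt0.
    exists (e / 2) => _; split=> //.
    have [N NP] := yc _ e20; exists N => // n /= Nn; rewrite leNgt.
    apply/negP => cn; apply: ne; exists n => // m /= nm.
    apply: le_lt_trans (dT _ (y n) _) _; rewrite (splitr e) ltrD //.
    by apply: NP => //; exact: leq_trans nm.
  have [|l lP] := compact_finite_subcover
      (V := fun x => [set y | d x y < r x]) (cF s0).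
    by move=> x /rP[r0 _]; exact: nbhs_metric.
  pose l' := [seq c <- l | `[< F s0 c >]].
  pose U := \bigcup_(c in [set` l']) [set y | d c y < r c].
  have nU : nbhs s0 [set t | F t `<=` U].
    apply: oF; first by apply: bigcup_open => c _; exact: open_metric_ball.
    move=> z /lP[c [cl Fc cz]]; exists c => //=.
    by rewrite mem_filter cl andbT; apply/asboolP.
  have near1 : \forall n \near \oo, F (s n) `<=` U := ss0 _ nU.
  have near2 : \forall n \near \oo, forall c, c \in l' -> r c <= d c (y n).
    apply: filter_forall_mem => c; rewrite mem_filter => /andP[/asboolP Fc _].
    exact: (rP c Fc).2.
  have [n [n1 n2]] := filter_ex (filterI near1 near2).
  have [c /= cl cy] := n1 _ (Fsy n).
  by move: cy; rewrite ltNge n2.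
have P0 : (s0, y0) \in usco_graph by rewrite inE.
exists (exist _ (s0, y0) P0 : set_type usco_graph).
move=> A /nbhs_set_typeP[V [[V1 V2] /= [nV1 nV2] V12] VA].
have n1 : \forall n \near \oo, V1 (s n) := ss0 _ nV1.
have n2 : \forall n \near \oo, V2 (y n) := yy0 _ nV2.
suff : \forall n \near \oo, A (u n) by [].
by apply: filterS (filterI n1 n2) => n [V1n V2n]; apply: VA; exact: V12.
Qed.

Lemma usco_metrizable_analytic : analytic R T.
Proof.
exists (set_type usco_graph); first exact: usco_graph_polish.
exists (fun z => (set_val z).2).
  move=> z; apply: (@continuous_comp _ _ _ set_val snd).
    exact: set_val_continuous.
  exact: cvg_snd.
apply/seteqP; split=> // y _.
have [s _ Fsy] : (\bigcup_s F s) y by rewrite FT.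
have P0 : (s, y) \in usco_graph by rewrite inE.
by exists (exist _ (s, y) P0).
Qed.

End K_analytic_metrizable.

(** * Countability of the domain of a K-analytic function space *)

(** Otherwise [X] would be the union of the finite sets of points sharing a
    prefix of their codes, and there are countably many prefixes. *)
Lemma uncountable_condensation (X : Type) (C : countType)
    (beta : X -> nat -> C) :
  ~ countable [set: X] ->
  exists x0, forall n,
    infinite_set [set x | mkseq (beta x) n = mkseq (beta x0) n].
Proof.
apply: contra_notP => /forallNP fin.
pose cls (p : seq C) := [set x | mkseq (beta x) (size p) = p].
pose good := [set p | finite_set (cls p)].
suff -> : [set: X] = \bigcup_(p in good) cls p.
  apply: bigcup_countable; first exact: countableP.
  by move=> p pg; exact: finite_set_countable.
apply/seteqP; split=> // x _.
have /existsNP[n /contrapT xn] := fin x.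
by exists (mkseq (beta x) n); rewrite /good /cls /= size_mkseq.
Qed.

(** Choose the points one after the other, each outside the finite list of the
    previous ones. *)
Lemma infinite_sets_injection (X : choiceType) (E : nat -> set X) :
  (forall n, infinite_set (E n)) ->
  exists a : nat -> X, injective a /\ forall n, E n (a n).
Proof.
move=> infE; have [x0 _] := infinite_setN0 (infE 0%N).
pose next n (l : seq X) := xget x0 (E n `\` [set` l]).
pose build := fix build n :=
  if n is m.+1 then next m (build m) :: build m else [::].
pose a n := next n (build n).
have aP n : E n (a n) /\ a n \notin build n.
  have [y Ey] : E n `\` [set` build n] !=set0.
    by apply: infinite_setN0; apply: infinite_setD => //; exact: finite_seq.
  by have [? /negP] := xgetPex x0 (ex_intro _ y Ey).
have mem_build m n : (m < n)%N -> a m \in build n.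
  elim: n => // n IH; rewrite ltnS leq_eqVlt => /orP[/eqP->|/IH amn] /=.
    exact: mem_head.
  by rewrite in_cons amn orbT.
exists a; split=> [m n amn|n]; last exact: (aP n).1.
have [mn|nm|//] := ltngtP m n.
  by have := (aP n).2; rewrite -amn mem_build.
by have := (aP m).2; rewrite amn mem_build.
Qed.

Definition seq_support (X : choiceType) (G : zmodType) (a : nat -> X) :
    set (X -> G) :=
  [set f | forall x, ~ range a x -> f x = 0].

(** The code of [x] at a finite sequence [p] is an index [k] such that all
    functions in the image of the cylinder [p] take values in [O k] at [x].
    If [h] belongs to [F s], some prefix [p] of [s] has such an index [k'] at
    the condensation point [x0], and almost all points [a n] share it.  Hence
    [h] takes values in [O k'] at almost all [a n], whereas the chosen [h] is
    outside [O n] there. *)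
Lemma K_analytic_sigma_countable (X : choiceType) (G : topologicalZmodType)
    (H : set (X -> G)) (O : nat -> set G) :
  (forall n, open (O n)) -> (forall m n, (m <= n)%N -> O m `<=` O n) ->
  \bigcup_n O n = [set: G] -> (forall n, O n <> [set: G]) ->
  (forall a, seq_support a `<=` H) ->
  K_analytic (ptws_subspace H) -> countable [set: X].
Proof.
move=> oO incO OT OnT Hsupp [F [cF uF] FT]; apply: contrapT => Xunc.
pose good x (p : seq nat) k := forall t : NN,
  prefix_cylinder (size p) (nth 0%N p) t ->
  forall h, F t h -> O k (subspace_eval H x h).
pose beta x i : option nat :=
  if pselect (exists k, good x (odflt [::] (unpickle i)) k) is left e
  then Some (projT1 (cid e)) else None.
have betaP x p k : beta x (pickle p) = Some k -> good x p k.
  rewrite /beta pickleK /=; case: pselect => // e [<-].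
  exact: (projT2 (cid e)).
have beta_good x p k : good x p k -> exists k', beta x (pickle p) = Some k'.
  move=> gk; rewrite /beta pickleK /=.
  case: pselect => [e|[]]; last by exists k.
  by exists (projT1 (cid e)).
have [x0 infE] := uncountable_condensation beta Xunc.
have [a [ainj aE]] := infinite_sets_injection infE.
have /choice[g gP] : forall n, exists g, ~ O n g.
  move=> n; apply: contrapT => /forallNP no; apply: (OnT n).
  by apply/seteqP; split=> // g _; exact: contrapT (no g).
pose h y :=
  if pselect (exists n, a n = y) is left e then g (projT1 (cid e)) else 0.
have ha n : h (a n) = g n.
  rewrite /h; case: pselect => [e|[]]; last by exists n.
  by congr g; apply: ainj; exact: (projT2 (cid e)).
have Hh : h \in H.
  rewrite inE; apply: (Hsupp a) => x nx; rewrite /h.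
  by case: pselect => // -[n ax]; case: nx; exists n.
pose hH : ptws_subspace H := exist _ h Hh.
have [s _ Fs] : (\bigcup_s F s) hH by rewrite FT.
have [k Fk] : exists k, subspace_eval H x0 @` F s `<=` O k.
  apply: compact_sub_increasing => //; first by rewrite OT.
  apply: continuous_compact (cF s); apply: continuous_subspaceT.
  exact: subspace_eval_continuous.
have /NN_nbhsP[N Ns] : nbhs s
    [set t | F t `<=` subspace_eval H x0 @^-1` O k].
  apply: uF.
    by apply: open_comp => // y _; exact: subspace_eval_continuous.
  by move=> y Fy; apply: Fk; exists y.
have [|k' k'P] := beta_good x0 (mkseq s N) k.
  move=> t; rewrite size_mkseq => ts y Fy; apply: (Ns t) => //.
  by move=> i iN; rewrite (ts i iN) nth_mkseq.
(* past both the position of this prefix in the codes and its recorded index *)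
pose n := maxn (pickle (mkseq s N)).+1 k'.
have : beta (a n) (pickle (mkseq s N)) = Some k'.
  have : nth None (mkseq (beta (a n)) n) (pickle (mkseq s N)) =
         nth None (mkseq (beta x0) n) (pickle (mkseq s N)) by rewrite aE.
  by rewrite !nth_mkseq ?leq_maxl // => ->.
move=> /betaP/(_ s _ hH Fs) O'.
apply: (gP n); rewrite -ha; apply: (incO _ _ (leq_maxr _ _)); apply: O'.
by rewrite size_mkseq => i iN; rewrite nth_mkseq.
Qed.

(** * Functions of low Baire class *)

Section functions.
Context (G : topologicalZmodType) (X : topologicalType).

Lemma cvgD_zmod (I : Type) (F : set_system I) (u v : I -> G) (a b : G) :
  Filter F ->
  u @ F --> a -> v @ F --> b -> (fun i => u i + v i) @ F --> a + b.
Proof.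
move=> FF ua vb.
apply: (@cvg_comp _ _ _ (fun i => (u i, v i)) (fun p : G * G => p.1 + p.2)
  _ (nbhs (a, b))); last exact: (add_continuous (a, b)).
exact: (cvg_pair ua vb).
Qed.

Lemma continuousD_zmod (u v : X -> G) :
  continuous u -> continuous v -> continuous (fun x => u x + v x).
Proof. by move=> cu cv x; apply: cvgD_zmod; [exact: cu|exact: cv]. Qed.

Lemma baire1D (f g : X -> G) : baire_class 1 f -> baire_class 1 g ->
  baire_class 1 (fun x => f x + g x).
Proof.
move=> [u [cu uf]] [v [cv vg]].
exists (fun n x => u n x + v n x); split=> [n|x].
  exact: continuousD_zmod (cu n) (cv n).
exact: cvgD_zmod.
Qed.

Lemma baire1_cst (g : G) : baire_class 1 (fun _ : X => g).
Proof. by exists (fun _ _ => g); split=> [n x|x]; exact: cvg_cst. Qed.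

Hypothesis XG : relatively_tychonoff G X.
Hypothesis X_T1 : accessible_space X.

Lemma separating_function (A : set X) (x : X) (g : G) : closed A -> ~ A x ->
  exists f : X -> G, [/\ continuous f, f x = g & forall a, A a -> f a = 0].
Proof.
move=> cA nAx; have [->|/eqP g0] := eqVneq g 0; last exact: XG.
by exists (fun=> 0); split=> // y; exact: cvg_cst.
Qed.

(** The [n]-th approximation agrees with [f] on the points numbered below [n];
    it is corrected at one more point by adding a function that vanishes on the
    previous ones, a finite and therefore closed set. *)
Lemma baire1_countable (f : X -> G) : countable [set: X] -> baire_class 1 f.
Proof.
move=> /countable_injP[c cinj].
have /choice[u uP] : forall n, exists u : X -> G,
    continuous u /\ forall x, (c x < n)%N -> u x = f x.
  elim=> [|n [u [cu uf]]].
    by exists (fun=> 0); split=> // x; exact: cvg_cst.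
  have [[x cx]|nx] := pselect (exists x, c x = n); last first.
    exists u; split=> // x; rewrite ltnS leq_eqVlt => /orP[/eqP cx|].
      by case: nx; exists x.
    exact: uf.
  have clA : closed [set y | (c y < n)%N].
    apply: (accessible_finite_set_closed.1 X_T1).
    apply: (@finite_preimage _ _ `I_n c); last exact: finite_II.
    by move=> y z _ _; apply: cinj; rewrite inE.
  have [|v [cv vx v0]] := @separating_function _ x (f x - u x) clA.
    by rewrite /= cx ltnn.
  exists (fun y => u y + v y); split; first exact: continuousD_zmod.
  move=> y; rewrite ltnS leq_eqVlt => /orP[/eqP cy|cy];
    last by rewrite v0 // addr0 uf.
  have -> : y = x by apply: cinj; rewrite ?inE // cy.
  by rewrite vx addrC subrK.
exists u; split=> [n|x]; first exact: (uP n).1.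
apply: cvg_near_cst; exists (c x).+1 => // n /= cxn.
exact: (uP n).2.
Qed.

Hypothesis X_fc : first_countable X.

Definition point_fun (x : X) (g : G) : X -> G :=
  fun y => if y == x then g else 0.

Lemma point_fun_id x g : point_fun x g x = g.
Proof. by rewrite /point_fun eqxx. Qed.

(** Use continuous functions with value [g] at [x] that vanish off the [n]-th
    member of a decreasing neighbourhood base at [x]. *)
Lemma point_fun_baire1 x g : baire_class 1 (point_fun x g).
Proof.
have [U [nU bU]] := X_fc x.
pose W n := interior [set y | forall i : 'I_n.+1, U i y].
have nW n : nbhs x (W n).
  apply: nbhs_interior.
  by apply: (@filter_forall X 'I_n.+1 (fun i => U i) (nbhs x)) => i; exact: nU.
have /choice[u uP] : forall n, exists u : X -> G,
    [/\ continuous u, u x = g & forall y, (~` W n) y -> u y = 0].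
  move=> n; apply: separating_function; first exact/open_closedC/open_interior.
  by move=> /=; apply; exact: nbhs_singleton.
exists u; split=> [n|y]; first by case: (uP n).
rewrite /point_fun; have [->|yx] := eqVneq y x.
  by apply: cvg_near_cst; apply: nearW => n; case: (uP n).
have nV : nbhs x (~` [set y]).
  apply: open_nbhs_nbhs; split; last by move=> /= xy; move: yx; rewrite xy eqxx.
  by apply: closed_openC; exact: accessible_closed_set1.
have [N NV] := bU _ nV.
apply: cvg_near_cst; exists N => // n /= Nn; case: (uP n) => _ _; apply.
by move=> /interior_subset /(_ (Ordinal (Nn : (N < n.+1)%N)))/NV; exact.
Qed.

Definition seq_restr (l : seq X) (f : X -> G) : X -> G :=
  fun y => if y \in l then f y else 0.

Lemma seq_restr_baire1 l f : baire_class 1 (seq_restr l f).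
Proof.
elim: l => [|x l IH]; first exact: baire1_cst.
have [xl|xl] := boolP (x \in l).
  rewrite (_ : seq_restr _ _ = seq_restr l f) //; apply/funext => y.
  by rewrite /seq_restr in_cons; case: eqP => // ->; rewrite xl.
rewrite (_ : seq_restr _ _ = fun y => point_fun x (f x) y + seq_restr l f y).
  by apply: baire1D => //; exact: point_fun_baire1.
apply/funext => y; rewrite /seq_restr /point_fun in_cons.
by case: eqP => [->|_]; rewrite ?(negbTE xl) ?addr0 ?add0r.
Qed.

(** Its restrictions to finite sets are finite sums of functions supported by
    one point. *)
Lemma seq_support_baire2 a : @seq_support X G a `<=` baire_class 2.
Proof.
move=> f fa; exists (fun n => seq_restr (mkseq a n) f); split=> [n|x].
  by right; exact: seq_restr_baire1.
have [[N _ ax]|nx] := pselect (range a x).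
  apply: cvg_near_cst; exists N.+1 => // n /= Nn.
  rewrite /seq_restr ifT // -ax; apply/mapP; exists N => //.
  by rewrite mem_iota.
rewrite fa //; apply: cvg_near_cst; apply: nearW => n.
by rewrite /seq_restr; case: ifP => // _; exact: fa.
Qed.

End functions.

(** * The group and the function space *)

Section group.
Context (R : realType) (G : topologicalZmodType).
Hypothesis Gm : metrizable R G.

Lemma metrizable_group_hausdorff : hausdorff_space G.
Proof. by have [d [dm dt]] := Gm; exact: (metric_hausdorff dm dt). Qed.

Lemma compact_precompact_group : compact [set: G] -> precompact_group G.
Proof.
move=> cG U nU.
have [|l lP] := compact_finite_subcover (V := fun x => [set y | U (y - x)]) cG.
  move=> x _; have : (fun y : G => y - x) @ x --> x - x.
    by apply: cvgD_zmod; [exact: cvg_id|exact: cvg_cst].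
  by rewrite subrr => /(_ U nU).
exists [set` l]; first exact: finite_seq.
apply/seteqP; split=> // y _; have [c [cl _ Uc]] := lP y I.
by exists c => //; exists (y - c) => //; rewrite addrC subrK.
Qed.

Lemma nonprecompact_neq0 : ~ precompact_group G -> exists g : G, g <> 0.
Proof.
apply: contra_notP => /forallNP G0 U nU.
exists [set 0]; first exact: finite_set1.
apply/seteqP; split=> // g _; exists 0 => //.
exists 0; first exact: nbhs_singleton.
by rewrite addr0; symmetry; apply: contrapT; exact: G0.
Qed.

(** Finite unions of translates of an open neighbourhood of [0], centred at
    the points of a dense sequence, where finitely many translates of that
    neighbourhood do not cover [G]. *)
Lemma nonprecompact_open_cover : separable G -> ~ precompact_group G ->
  exists O : nat -> set G, [/\ forall n, open (O n),
    forall m n, (m <= n)%N -> O m `<=` O n,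
    \bigcup_n O n = [set: G] & forall n, O n <> [set: G]].
Proof.
move=> /(separable_enum 0)[e de] /existsNP[U /not_implyP[nU noF]].
have subc (c : G) : continuous (fun g : G => g - c).
  by move=> g; apply: cvgD_zmod; [exact: cvg_id|exact: cvg_cst].
pose O n := \bigcup_(i in `I_n) [set g | interior U (g - e i)].
exists O; split.
- move=> n; apply: bigcup_open => i _.
  apply: (@open_comp _ _ (fun g : G => g - e i)); last exact: open_interior.
  by move=> g _; exact: subc.
- by move=> m n mn g [i /= im Ui]; exists i => //=; exact: leq_trans mn.
- apply/seteqP; split=> // g _.
  have : (fun y : G => g - y) @ g --> g - g.
    apply: cvgD_zmod; [exact: cvg_cst|exact: opp_continuous].
  rewrite subrr => /(_ _ (nbhs_interior nU))/de[n Un].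
  by exists n.+1 => //; exists n => /=.
- move=> n On; apply: noF.
  exists (e @` `I_n); first exact/finite_image/finite_II.
  apply/seteqP; split=> // g _; have [i /= iN Ui] : O n g by rewrite On.
  exists (e i); first by exists i.
  by exists (g - e i); [exact: interior_subset|rewrite addrC subrK].
Qed.

End group.

Lemma ptws_subspace_full (X : choiceType) (G : topologicalType)
    (H : set (X -> G)) : (forall f, H f) ->
  exists2 mk : {ptws X -> G} -> ptws_subspace H,
    continuous mk & forall f, set_val (mk f) = f.
Proof.
move=> HT; exists (fun f => exist _ f (mem_set (HT f))) => //.
by apply: continuous_set_type => f; exact: cvg_id.
Qed.

Lemma ptws_subspace_full_image (X : choiceType) (G : topologicalType)
    (H : set (X -> G)) : (forall f, H f) ->
  continuous_image {ptws X -> G} (ptws_subspace H).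
Proof.
move=> /ptws_subspace_full[mk cmk mkK]; exists mk => //.
apply/seteqP; split=> // h _; exists (set_val h) => //.
by apply: val_inj; exact: mkK.
Qed.

Lemma analytic_image (R : realType) (S T : topologicalType) :
  analytic R S -> continuous_image S T -> analytic R T.
Proof.
by move=> [Z pZ ZS] ST; exists Z => //; exact: continuous_image_trans ST.
Qed.

Lemma locally_compactTP (T : topologicalType) : locally_compact [set: T] <->
  forall x : T, exists K, [/\ nbhs x K, compact K & closed K].
Proof.
split=> [lc x|lc x _].
  have [K nK [cK clK]] := lc x I; exists K; split=> //.
  by apply: (@filterS _ (nbhs x) _ (fun t => [set: T] t -> K t)) nK => y; exact.
have [K [nK cK clK]] := lc x; exists K => //.
by apply: filterS nK => y Ky _.
Qed.

(** The two hypotheses on [H] are what containing the first Baire class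
    provides. *)
Section subgroups.
Context (R : realType) (G : topologicalZmodType) (X : topologicalType).
Context (H : set (X -> G)).
Hypotheses (Gm : metrizable R G) (Gnp : ~ precompact_group G).
Hypothesis Hpoint : forall x g, H (point_fun x g).
Hypothesis Hcount : countable [set: X] -> forall f, H f.
Variable x0 : X.

Let mkpoint x g : ptws_subspace H :=
  exist _ (point_fun x g) (mem_set (Hpoint x g)).

Lemma eval_image : continuous_image (ptws_subspace H) G.
Proof.
exists (subspace_eval H x0); first exact: subspace_eval_continuous.
apply/seteqP; split=> // g _; exists (mkpoint x0 g) => //.
exact: point_fun_id.
Qed.

Lemma cosmic_countable : cosmic R (ptws_subspace H) -> countable [set: X].
Proof.
have [g g0] := nonprecompact_neq0 Gnp.
move=> /(@cosmic_discrete_family R (ptws_subspace H) X (fun x => mkpoint x g)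
  (fun x => subspace_eval H x @^-1` (~` [set 0]))).
apply.
- move=> x; apply: open_comp.
    by move=> h _; exact: subspace_eval_continuous.
  apply/closed_openC/accessible_closed_set1/hausdorff_accessible.
  exact: (metrizable_group_hausdorff Gm).
- move=> x; suff : ~ (point_fun x g x = 0) by [].
  by rewrite point_fun_id.
- move=> x y; suff : point_fun y g x <> 0 -> x = y by [].
  by rewrite /point_fun; case: eqP.
Qed.

(** A compact neighbourhood of the zero function contains a box over a finite
    set [D] of coordinates, thus all one-point functions at any [y] outside
    [D]; evaluating at [y] would make [G] compact. *)
Lemma locally_compact_iff : locally_compact [set: ptws_subspace H] <->
  finite_set [set: X] /\ locally_compact [set: G].
Proof.
have hG := metrizable_group_hausdorff Gm.
rewrite !locally_compactTP; split=> [lcH|[finX lcG]].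
  have lc x g : exists D (U : X -> set G) (K : X -> set G), [/\ finite_set D,
      forall i, nbhs (point_fun x g i) (U i), forall y, compact (K y) &
      forall y g', (forall i, D i -> U i (point_fun y g' i)) -> K y g'].
    have [K [+ cK _]] := lcH (mkpoint x g).
    move=> /nbhs_set_typeP[V /ptws_nbhs_box[D [U [finD nU DU]]] VK].
    exists D, U, (fun y => subspace_eval H y @` K).
    split=> // [y|y g' Dg].
      apply: continuous_compact => //; apply: continuous_subspaceT.
      exact: subspace_eval_continuous.
    exists (mkpoint y g'); first by apply: VK; exact: DU.
    exact: point_fun_id.
  split.
    apply: contrapT => infX; apply: Gnp; apply: compact_precompact_group.
    have [D [U [K [finD nU cK UK]]]] := lc x0 0.
    have [y Dy] : exists y, ~ D y.
      apply: contrapT => /forallNP DX; apply: infX.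
      by apply: sub_finite_set finD => y _; exact: contrapT (DX y).
    rewrite (_ : [set: G] = K y) //; apply/seteqP; split=> // g _.
    apply: UK => i Di; have := nbhs_singleton (nU i).
    rewrite /point_fun; case: (eqVneq i y) => [iy|_]; last by rewrite if_same.
    by case: Dy; rewrite -iy.
  move=> g; have [D [U [K [_ nU cK UK]]]] := lc x0 g.
  exists (K x0); split; [|exact: cK|exact: compact_closed].
  have := nU x0; rewrite {1}/point_fun eqxx.
  apply: filterS => g' Ug'; apply: UK.
  move=> i _; rewrite /point_fun; have [->//|ix] := eqVneq i x0.
  by have := nbhs_singleton (nU i); rewrite /point_fun (negbTE ix).
have HT := Hcount (finite_set_countable finX).
have [mk cmk mkK] := ptws_subspace_full HT.
move=> h.
have /choice[K KP] : forall x, exists K : set G,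
    [/\ nbhs (subspace_eval H x h) K, compact K & closed K].
  by move=> x; exact: lcG.
exists [set k : ptws_subspace H | forall x, K x (subspace_eval H x k)]; split.
- have /finite_seqP[l lX] := finX.
  have nh : nbhs h [set k : ptws_subspace H |
      forall x, x \in l -> K x (subspace_eval H x k)].
    apply: (@filter_forall_mem _ X (nbhs h) l
      (fun x => [set k : ptws_subspace H | K x (subspace_eval H x k)])) => x _.
    by apply: (@subspace_eval_continuous X G H x h); case: (KP x).
  apply: filterS nh => k kK x; apply: kK.
  by have : [set: X] x by []; rewrite lX.
- rewrite (_ : mkset _ = mk @` [set f : {ptws X -> G} | forall x, K x (f x)]).
    apply: continuous_compact; first exact: continuous_subspaceT.
    by apply: (@tychonoff X (fun=> G)) => x; case: (KP x).
  apply/seteqP; split=> [k kK|_ [f fK <-] x];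
    last by rewrite /subspace_eval mkK.
  by exists (set_val k) => //; apply: val_inj; exact: mkK.
- rewrite (_ : mkset _ = \bigcap_x (subspace_eval H x @^-1` K x)).
    apply: closed_bigI => x _; apply: closed_comp; last by case: (KP x).
    by move=> k _; exact: subspace_eval_continuous.
  by apply/seteqP; split=> [k kK x _|k kK x]; [exact: kK|exact: (kK x I)].
Qed.

Lemma cosmic_iff :
  cosmic R (ptws_subspace H) <-> countable [set: X] /\ separable G.
Proof.
split=> [cH|[cX sG]].
  split; first exact: cosmic_countable.
  have [Z [sZ _ ZH]] := cH.
  exact: (separable_image sZ (continuous_image_trans ZH eval_image)).
have [d [dm dt]] := Gm.
exists {ptws nat -> G}; split; first exact: (seq_separable dm dt).
  exists (seq_metric d).
  by split; [exact: seq_metric_is_metric|exact: seq_metric_induces].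
apply: continuous_image_trans (ptws_subspace_full_image (Hcount cX)).
exact: (seq_image_ptws 0 cX (@continuous_image_refl G)).
Qed.

Lemma analytic_iff :
  analytic R (ptws_subspace H) <-> countable [set: X] /\ analytic R G.
Proof.
split=> [aH|[cX [S pS SG]]].
  split; last exact: (analytic_image aH eval_image).
  have [S [sS [d [dm dt _]]] SH] := aH.
  by apply: cosmic_countable; exists S; split=> //; exists d.
have [s0 _] : exists s0 : S, True.
  by have [f _ fT] := SG; have [s _ _] : range f 0 by [rewrite fT]; exists s.
exists {ptws nat -> S}; first exact: polish_seq.
apply: continuous_image_trans (ptws_subspace_full_image (Hcount cX)).
exact: seq_image_ptws.
Qed.

Lemma K_analytic_iff : (forall a, @seq_support X G a `<=` H) ->
  K_analytic (ptws_subspace H) <-> analytic R (ptws_subspace H).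
Proof.
move=> Hsupp; split=> [kH|]; last exact: (analytic_K_analytic (mkpoint x0 0)).
have [F uF FT] := K_analytic_image kH eval_image.
have [d [dm dt]] := Gm.
apply/analytic_iff; split; last exact: (usco_metrizable_analytic dm dt uF FT).
have sG := usco_metrizable_separable dm dt uF FT.
have [V [oV incV VT VnT]] := nonprecompact_open_cover sG Gnp.
exact: K_analytic_sigma_countable kH.
Qed.

End subgroups.

Theorem corollary3p13 (R : realType) (G : topologicalZmodType)
    (X : topologicalType) (H : set (X -> G))
    (G_metrizable : metrizable R G)
    (G_nonprecompact : ~ precompact_group G)
    (X_nonempty : [set: X] !=set0)
    (X_tychonoff : tychonoff_space X)
    (X_G_tychonoff : relatively_tychonoff G X)
    (X_first_countable : first_countable X)
    (H_subgroup : is_subgroup H)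
    (H_baire1 : baire_class 1 `<=` H) :
  [/\ (* (E) *)
      locally_compact [set: ptws_subspace H] <->
        finite_set [set: X] /\ locally_compact [set: G],
      (* (F) *)
      cosmic R (ptws_subspace H) <-> countable [set: X] /\ separable G,
      (* (G) *)
      analytic R (ptws_subspace H) <-> countable [set: X] /\ analytic R G &
      (* (H) *)
      baire_class 2 `<=` H ->
        (K_analytic (ptws_subspace H) <-> analytic R (ptws_subspace H)) /\
        (analytic R (ptws_subspace H) <->
           countable [set: X] /\ analytic R G)].
Proof.
have [x0 _] := X_nonempty.
have X_T1 := hausdorff_accessible X_tychonoff.1.
have Hpoint x g : H (point_fun x g).
  by apply: H_baire1; exact: point_fun_baire1.
have Hcount : countable [set: X] -> forall f, H f.
  by move=> cX f; apply: H_baire1; exact: baire1_countable.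
have X_analytic := analytic_iff G_metrizable G_nonprecompact Hpoint Hcount x0.
split=> //; [|exact: cosmic_iff|].
  exact: (locally_compact_iff G_metrizable G_nonprecompact Hpoint Hcount x0).
move=> H_baire2; split => //.
apply: (K_analytic_iff G_metrizable G_nonprecompact Hpoint Hcount x0) => a f.
by move=> /(seq_support_baire2 X_G_tychonoff X_T1 X_first_countable)/H_baire2.
Qed.
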